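(* Consider an execution of Flutter (server and client algorithms as in the context, with every Representative Binary Consensus instance $con[(\theta,m,b)]$ implemented by Blink) that satisfies the good-case assumptions stated in the context. Let $\theta\in\Theta$ be a client, let $m\in\mathcal M$, and let $t$ be a time such that $\theta$ triggers $\langle tob.\mathrm{Broadcast}\mid m\rangle$ at time $t$. Then every server triggers $\langle tob.\mathrm{Deliver}\mid \theta,m\rangle$ by time $t+2\Delta+\epsilon$.
   Context: **Model.** $f\ge 0$ is an integer; $\Pi$ is a fixed, commonly known set of $n=5f+1$ servers; $\Theta$ is a set of clients (which may overlap with $\Pi$); $\mathcal M$ is the set of messages; $\mathbb T$ denotes times (real numbers). Any two processes (including a process and itself) communicate via reliable, authenticated, FIFO links; the delay of every message is at most $\Delta$. Event handlers execute atomically, and a process delivers only finitely many messages in finite time. Local clocks are non-decreasing; $local\_time()$ reads the local clock. **Good-case assumptions.** All processes (servers and clients) are correct, i.e. follow the algorithm; local computation is instantaneous; the message delay bound $\Delta>0$ is known, so the clients' estimate satisfies $\tilde\Delta=\Delta$; all local clocks equal real time at all times. Correct clients never broadcast the same message twice. **Binary Consensus** (instance $dep$): every correct server proposes exactly one value of $\mathbb B=\{\mathtt{True},\mathtt{False}\}$ via $\langle dep.\mathrm{Propose}\mid p\rangle$, and may trigger $\langle dep.\mathrm{Decide}\mid d\rangle$. Integrity: no correct server decides more than once. Agreement: no two correct servers decide different values. Termination: if every correct server proposes, every correct server eventually decides. Validity: a decided value was proposed by at least one correct server. **Blink** (implements a Representative Binary Consensus instance $con$ using one Binary Consensus instance $dep$).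 Each server keeps a map $suggestions$ from $\Pi$ to $\mathbb B$ (initially empty) and flags $proposed=decided=\mathtt{False}$. (i) Upon $\langle con.\mathrm{Propose}\mid v\rangle$: send $[\mathtt{Suggest},v]$ to every server. (ii) Upon delivering $[\mathtt{Suggest},v]$ from $\sigma\in\Pi$: set $suggestions[\sigma]=v$. (iii) Upon $|suggestions|\ge 4f+1$ (number of keys) and $proposed=\mathtt{False}$: pick $v$ with $|\{\pi: suggestions[\pi]=v\}|\ge 2f+1$, trigger $\langle dep.\mathrm{Propose}\mid v\rangle$, set $proposed=\mathtt{True}$. (iv) Upon existence of $v$ with $|\{\pi: suggestions[\pi]=v\}|\ge 4f+1$: if $decided=\mathtt{False}$, trigger $\langle con.\mathrm{Decide}\mid v\rangle$ and set $decided=\mathtt{True}$. (v) Upon $\langle dep.\mathrm{Decide}\mid v\rangle$: if $decided=\mathtt{False}$, trigger $\langle con.\mathrm{Decide}\mid v\rangle$ and set $decided=\mathtt{True}$. **Order.** Fix total orders on $\Theta$ and $\mathcal M$; $\Theta\times\mathcal M\times\mathbb T$ is totally ordered by comparing first the time component, then the client, then the message. The initial value $(\bot,\bot,-\infty)$ is below every element. **Flutter, server algorithm.** There is one independent instance $con[(\theta,m,b)]$ for every $(\theta,m,b)\in\Theta\times\mathcal M\times\mathbb T$. Each server keeps sets $observed,proposed,candidates\subseteq\Theta\times\mathcal M\times\mathbb T$ and $delivered\subseteq\Theta\times\mathcal M$ (all initially empty), a map $remote\_times:\Pi\to\mathbb T\cup\{-\infty\}$ (initially constantly $-\infty$), a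 map $decisions$ from $\Theta\times\mathcal M\times\mathbb T$ to $\mathbb B$ (initially empty), and $last\_processed$ (initially $(\bot,\bot,-\infty)$). - $beat()$: send $[\mathtt{Time},local\_time()]$ to every server. - Upon delivering $[\mathtt{Time},t]$ from $\pi$: $remote\_times[\pi]=\max(remote\_times[\pi],t)$. - $lock\_time()$: return the maximum $t$ such that $|\{\pi: remote\_times[\pi]\ge t\}|\ge 4f+1$. - $spot(\theta,m,b)$: if $b>lock\_time()$, add $(\theta,m,b)$ to $candidates$. Then, if $(\theta,m,b)\notin observed$: send $[\mathtt{Observe},\theta,m,b]$ to every server, schedule $beat()$ for execution at local time $b$ (immediately if $b$ has already passed), and add $(\theta,m,b)$ to $observed$. - Upon delivering $[\mathtt{Observe},\theta,m,b]$ from a server: $spot(\theta,m,b)$. - Upon delivering $[\mathtt{Message},m,b]$ from a client $\theta$: $spot(\theta,m,b)$; then, if $(\theta,m,b)\notin proposed$: trigger $\langle con[(\theta,m,b)].\mathrm{Propose}\mid (b>local\_time())\rangle$ (the truth value of the inequality) and add $(\theta,m,b)$ to $proposed$. - Upon existence of $(\theta,m,b)\in observed\setminus proposed$ with $b\le local\_time()$: trigger $\langle con[(\theta,m,b)].\mathrm{Propose}\mid\mathtt{False}\rangle$ and add $(\theta,m,b)$ to $proposed$. - Upon $\langle con[(\theta,m,b)].\mathrm{Decide}\mid v\rangle$: send $[\mathtt{Decision},m,b,v]$ to $\theta$ and set $decisions[(\theta,m,b)]=v$. - Whenever the minimum $(\theta,m,b)$ among the elements of $candidates$ that are $>last\_processed$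 exists, is a key of $decisions$, and satisfies $b\le lock\_time()$: if $decisions[(\theta,m,b)]=\mathtt{True}$, call $order(\theta,m,b)$; then set $last\_processed=(\theta,m,b)$. - $order(\theta,m,b)$: if $(\theta,m)\notin delivered$, trigger $\langle tob.\mathrm{Deliver}\mid\theta,m\rangle$ and add $(\theta,m)$ to $delivered$. **Flutter, client algorithm.** Parameters: message-delay estimate $\tilde\Delta>0$ and a constant margin $\epsilon>0$ (arbitrarily small). Each client keeps maps $submissions$ from $\mathcal M$ to $\mathbb N\times\mathbb T$ and $decisions$ from $\mathcal M\times\mathbb T\times\Pi$ to $\mathbb B$ (initially empty). - $submit(m,r)$: let $b=local\_time()+2^r\tilde\Delta+\epsilon$; send $[\mathtt{Message},m,b]$ to every server; set $submissions[m]=(r,b)$. - Upon $\langle tob.\mathrm{Broadcast}\mid m\rangle$: $submit(m,0)$. - Upon delivering $[\mathtt{Decision},m,b,v]$ from server $\pi$: $decisions[(m,b,\pi)]=v$. - Upon existence of $m$ with $submissions[m]=(r,b)$ and $|\{\pi: decisions[(m,b,\pi)]=\mathtt{False}\}|\ge f+1$: $submit(m,r+1)$. *)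

(* Defs.v *)
(* MathComp, with the real numbers given by an abstract [R : realType]. *)
From HB Require Import structures.
From mathcomp Require Import all_boot all_order all_algebra.
From mathcomp Require Import finmap reals constructive_ereal.
Set Implicit Arguments.
Unset Strict Implicit.
Unset Printing Implicit Defensive.
Import Order.TTheory GRing.Theory Num.Theory.
Local Open Scope fset_scope.
Local Open Scope ring_scope.

(* Servers and clients are two index types; [srv] and [cli] below send them to
   processes, so that a process may be both a server and a client.  An element
   (theta, m, b) of Theta x M x T is a [key]; the initial value
   (bot, bot, -oo) of [last_processed] is [None].  *)

Section Algorithms.
Context {R : realType} {Server : finType} {dC dM : Order.disp_t}.
Context {Client : orderType dC} {Msg : orderType dM}.

Definition key : Type := (Client * Msg * R)%type.

(* Time first, then client, then message. *)
Definition rank (k : key) : R *l (Client *l Msg) := (k.2, (k.1.1, k.1.2)).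
Definition key_le (x y : key) : bool := (rank x <= rank y)%O.
Definition key_lt (x y : key) : bool := (rank x < rank y)%O.

(* Wire messages; a Suggest message carries the instance it belongs to. *)
Inductive wire : Type :=
| MSuggest of key & bool
| MTime of R
| MObserve of key
| MMessage of Msg & R
| MDecision of Msg & R & bool.

Inductive output : Type :=
| SendServers of wire
| SendClient of Client & wire
| DepPropose of key & bool
| TobDeliver of Client & Msg.

Record blink_state : Type := BlinkState {
  suggestions : {ffun Server -> option bool};
  dep_proposed : bool;
  decided : bool }.

(* [timers] is the multiset of local times at which beat() is scheduled.
   [con_proposals] and [con_decisions] hold the con.Propose and con.Decide
   events triggered on this server and not handled yet; they may be handled in
   any order, each by an atomic step of its own. *)
Record server_state : Type := ServerState {
  blink : key -> blink_state;
  con_proposals : seq (key * bool);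
  con_decisions : seq (key * bool);
  observed : {fset key};
  proposed : {fset key};
  candidates : {fset key};
  delivered : {fset Client * Msg};
  remote_times : {ffun Server -> \bar R};
  decisions : key -> option bool;
  last_processed : option key;
  timers : seq R }.

Record client_state : Type := ClientState {
  submissions : Msg -> option (nat * R);
  received : Msg * R * Server -> option bool }.

Definition init_blink : blink_state := BlinkState [ffun=> None] false false.
Definition init_server : server_state :=
  ServerState (fun=> init_blink) [::] [::] fset0 fset0 fset0 fset0
    [ffun=> -oo%E] (fun=> None) None [::].
Definition init_client : client_state := ClientState (fun=> None) (fun=> None).

Definition set_blink s k v := let: ServerState bl cp cd ob pr ca de rt ds lp ti := s
  in ServerState [eta bl with k |-> v] cp cd ob pr ca de rt ds lp ti.
Definition set_con_proposals s v :=
  let: ServerState bl cp cd ob pr ca de rt ds lp ti := s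
  in ServerState bl v cd ob pr ca de rt ds lp ti.
Definition set_con_decisions s v :=
  let: ServerState bl cp cd ob pr ca de rt ds lp ti := s
  in ServerState bl cp v ob pr ca de rt ds lp ti.
Definition set_observed s v := let: ServerState bl cp cd ob pr ca de rt ds lp ti := s
  in ServerState bl cp cd v pr ca de rt ds lp ti.
Definition set_proposed s v := let: ServerState bl cp cd ob pr ca de rt ds lp ti := s
  in ServerState bl cp cd ob v ca de rt ds lp ti.
Definition set_candidates s v := let: ServerState bl cp cd ob pr ca de rt ds lp ti := s
  in ServerState bl cp cd ob pr v de rt ds lp ti.
Definition set_delivered s v := let: ServerState bl cp cd ob pr ca de rt ds lp ti := s
  in ServerState bl cp cd ob pr ca v rt ds lp ti.
Definition set_remote_times s v :=
  let: ServerState bl cp cd ob pr ca de rt ds lp ti := s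
  in ServerState bl cp cd ob pr ca de v ds lp ti.
Definition set_decision s k v := let: ServerState bl cp cd ob pr ca de rt ds lp ti := s
  in ServerState bl cp cd ob pr ca de rt [eta ds with k |-> Some v] lp ti.
Definition set_last_processed s v :=
  let: ServerState bl cp cd ob pr ca de rt ds lp ti := s
  in ServerState bl cp cd ob pr ca de rt ds v ti.
Definition set_timers s v := let: ServerState bl cp cd ob pr ca de rt ds lp ti := s
  in ServerState bl cp cd ob pr ca de rt ds lp v.

Definition support (bl : blink_state) (v : bool) : nat :=
  #|[set p | suggestions bl p == Some v]|.
Definition suggested (bl : blink_state) : nat :=
  #|[set p | suggestions bl p != None]|.

Definition reaches (f : nat) (rt : {ffun Server -> \bar R}) (t : \bar R) : bool :=
  (4 * f + 1 <= #|[set p | (t <= rt p)%O]|)%N.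

(* The maximum is attained at a value of [remote_times]; see [lock_timeP]. *)
Definition lock_time (f : nat) (s : server_state) : \bar R :=
  \big[Order.max/-oo%E]_(p | reaches f (remote_times s) (remote_times s p))
    remote_times s p.

Lemma lock_timeP (f : nat) (s : server_state) :
  #|Server| = (5 * f + 1)%N ->
  reaches f (remote_times s) (lock_time f s) /\
  forall t, reaches f (remote_times s) t -> (t <= lock_time f s)%O.
Proof.
move=> hn; set rt := remote_times s; split.
  rewrite /lock_time -/rt.
  apply: (big_ind (fun t => reaches f rt t)) => [|a b ha hb|//].
    have E : [set p | (-oo%E <= rt p)%O] = [set: Server].
      by apply/setP => p; rewrite !inE leNye.
    by rewrite /reaches E cardsT hn leq_add2r leq_mul2r orbT.
  by rewrite /Order.max; case: ifP.
move=> t ht.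
have [p0 hp0] : exists p, p \in [set p | (t <= rt p)%O].
  by apply/card_gt0P; apply: leq_trans ht; rewrite addn1.
rewrite inE in hp0.
case: (@arg_minP _ _ _ p0 (fun p => (t <= rt p)%O) rt hp0) => p hp pmin.
have hr : reaches f rt (rt p).
  apply: (leq_trans ht); apply/subset_leq_card/subsetP => q; rewrite !inE.
  exact: pmin.
apply: (le_trans hp); rewrite /lock_time -/rt.
rewrite (bigD1 p) //=.
by rewrite le_max lexx.
Qed.

Inductive server_event : Type :=
| RecvSuggest of Server & key & bool
| RecvTime of Server & R
| RecvObserve of Server & key
| RecvMessage of Client & Msg & R
| DepDecide of key & bool
| HandlePropose of key & bool   (* con.Propose *)
| HandleDecide of key & bool    (* con.Decide *)
| QuorumPropose of key & bool   (* triggers dep.Propose *)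
| QuorumDecide of key & bool    (* triggers con.Decide *)
| Beat of R
| Expire of key
| Process of key.

Inductive client_event : Type :=
| Broadcast of Msg
| RecvDecision of Server & Msg & R & bool
| Retry of Msg.

Section Handlers.
Variable f : nat.
(* Value of local_time(). *)
Variable now : R.

Definition spot (s : server_state) (k : key) : server_state * seq output :=
  let s1 := if (lock_time f s < k.2%:E)%O
            then set_candidates s (k |` candidates s) else s in
  if k \in observed s1 then (s1, [::])
  else (set_observed (set_timers s1 (k.2 :: timers s1)) (k |` observed s1),
        [:: SendServers (MObserve k)]).

Definition con_propose (s : server_state) (k : key) (v : bool) : server_state :=
  let s1 := set_con_proposals s ((k, v) :: con_proposals s) in
  set_proposed s1 (k |` proposed s1).

Definition con_decide (s : server_state) (k : key) (v : bool) : server_state :=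
  let bl := blink s k in
  if decided bl then s else
  set_blink (set_con_decisions s ((k, v) :: con_decisions s)) k
    (BlinkState (suggestions bl) (dep_proposed bl) true).

Definition order (s : server_state) (c : Client) (m : Msg) :
    server_state * seq output :=
  if (c, m) \in delivered s then (s, [::])
  else (set_delivered s ((c, m) |` delivered s), [:: TobDeliver c m]).

Definition server_handle (s : server_state) (e : server_event) :
    server_state * seq output :=
  match e with
  | RecvSuggest p k v =>
      let bl := blink s k in
      (set_blink s k (BlinkState
         [ffun q => if q == p then Some v else suggestions bl q]
         (dep_proposed bl) (decided bl)), [::])
  | RecvTime p t =>
      (set_remote_times s
         [ffun q => if q == p then Order.max (remote_times s q) t%:E
                    else remote_times s q], [::])
  | RecvObserve _ k => spot s k
  | RecvMessage c m b =>
      let k : key := (c, m, b) in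
      let: (s1, o) := spot s k in
      if k \in proposed s1 then (s1, o) else (con_propose s1 k (now < b), o)
  | DepDecide k v => (con_decide s k v, [::])
  | HandlePropose k v =>
      (set_con_proposals s (rem (k, v) (con_proposals s)),
       [:: SendServers (MSuggest k v)])
  | HandleDecide k v =>
      (set_decision (set_con_decisions s (rem (k, v) (con_decisions s))) k v,
       [:: SendClient k.1.1 (MDecision k.1.2 k.2 v)])
  | QuorumPropose k v =>
      let bl := blink s k in
      (set_blink s k (BlinkState (suggestions bl) true (decided bl)),
       [:: DepPropose k v])
  | QuorumDecide k v => (con_decide s k v, [::])
  | Beat b => (set_timers s (rem b (timers s)), [:: SendServers (MTime now)])
  | Expire k => (con_propose s k false, [::])
  | Process k =>
      let: (s1, o) :=
        if decisions s k == Some true then order s k.1.1 k.1.2 else (s, [::]) in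
      (set_last_processed s1 (Some k), o)
  end.

Definition unprocessed (s : server_state) (k : key) : Prop :=
  if last_processed s is Some l then key_lt l k else True.

(* Guards of the locally triggered handlers.  In [QuorumDecide] the guard
   includes the test [decided = False] of the handler's body, whose execution
   has no effect otherwise. *)
Definition server_enabled (s : server_state) (e : server_event) : Prop :=
  match e with
  | HandlePropose k v => (k, v) \in con_proposals s
  | HandleDecide k v => (k, v) \in con_decisions s
  | QuorumPropose k v =>
      [/\ (4 * f + 1 <= suggested (blink s k))%N,
          ~~ dep_proposed (blink s k) &
          (2 * f + 1 <= support (blink s k) v)%N]
  | QuorumDecide k v =>
      (4 * f + 1 <= support (blink s k) v)%N /\ ~~ decided (blink s k)
  | Beat b => b \in timers s /\ b <= now
  | Expire k => [/\ k \in observed s, k \notin proposed s & k.2 <= now]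
  | Process k =>
      [/\ k \in candidates s /\ unprocessed s k,
          (forall k', k' \in candidates s -> unprocessed s k' -> key_le k k'),
          decisions s k != None &
          (k.2%:E <= lock_time f s)%O]
  | _ => False
  end.

(* [est] is the client's estimate of the delay bound, [eps] its margin. *)
Variables est eps : R.

Definition submit (s : client_state) (m : Msg) (r : nat) :
    client_state * seq output :=
  let b := now + 2 ^+ r * est + eps in
  (ClientState [eta submissions s with m |-> Some (r, b)] (received s),
   [:: SendServers (MMessage m b)]).

Definition client_handle (s : client_state) (e : client_event) :
    client_state * seq output :=
  match e with
  | Broadcast m => submit s m 0
  | RecvDecision p m b v =>
      (ClientState (submissions s)
         [eta received s with (m, b, p) |-> Some v], [::])
  | Retry m =>
      if submissions s m is Some (r, _) then submit s m r.+1 else (s, [::])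
  end.

Definition client_enabled (s : client_state) (e : client_event) : Prop :=
  if e is Retry m then
    exists r b, submissions s m = Some (r, b) /\
      (f + 1 <= #|[set p | received s (m, b, p) == Some false]|)%N
  else False.

End Handlers.
End Algorithms.

Arguments key R {dC dM} Client Msg.
Arguments wire R {dC dM} Client Msg.
Arguments output R {dC dM} Client Msg.
Arguments server_state R Server {dC dM} Client Msg.
Arguments client_state R Server {dM} Msg.
Arguments server_event R Server {dC dM} Client Msg.
Arguments client_event R Server {dM} Msg.
Arguments init_server {R Server dC dM Client Msg}.
Arguments init_client {R Server dM Msg}.

Section Executions.
Context {R : realType} {Server : finType} {dC dM : Order.disp_t}.
Context {Client : orderType dC} {Msg : orderType dM} {Proc : eqType}.

Inductive event : Type :=
| Idle
| AtServer of Server & server_event R Server Client Msg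
| AtClient of Client & client_event R Server Msg.

(* [links p q] lists, oldest first, the messages sent by p to q that q has not
   delivered yet, each with its sending time. *)
Record system : Type := System {
  servers : Server -> server_state R Server Client Msg;
  clients : Client -> client_state R Server Msg;
  links : Proc -> Proc -> seq (wire R Client Msg * R) }.

Definition init_system : system :=
  System (fun=> init_server) (fun=> init_client) (fun _ _ => [::]).

(* An execution interleaves the steps of all processes in one sequence: the
   i-th step is [events x i], taken at real time [times x i]. *)
Record run : Type := Run { events : nat -> event; times : nat -> R }.

Variable f : nat.
Variable srv : Server -> Proc.
Variable cli : Client -> Proc.
Variable Delta : R.
Variables est eps : R.
Variable clock : Proc -> R -> R.

Definition recipient (o : output R Client Msg) :
    option (pred Proc * wire R Client Msg) :=
  match o with
  | SendServers w => Some ((fun q => q \in codom srv), w)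
  | SendClient c w => Some ((fun q => q == cli c), w)
  | _ => None
  end.

Definition send (now : R) (p : Proc) (l : Proc -> Proc -> seq (wire R Client Msg * R))
    (o : output R Client Msg) : Proc -> Proc -> seq (wire R Client Msg * R) :=
  fun p' q =>
    if recipient o is Some (dst, w) then
      if (p' == p) && dst q then rcons (l p' q) (w, now) else l p' q
    else l p' q.

(* The link and the message that a delivery event consumes. *)
Definition incoming (e : event) : option (Proc * Proc * wire R Client Msg) :=
  match e with
  | AtServer s (RecvSuggest p k v) => Some (srv p, srv s, MSuggest k v)
  | AtServer s (RecvTime p t) => Some (srv p, srv s, MTime t)
  | AtServer s (RecvObserve p k) => Some (srv p, srv s, MObserve k)
  | AtServer s (RecvMessage c m b) => Some (cli c, srv s, MMessage m b)
  | AtClient c (RecvDecision p m b v) => Some (srv p, cli c, MDecision m b v)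
  | _ => None
  end.

Definition consume (e : event) (l : Proc -> Proc -> seq (wire R Client Msg * R)) :
    Proc -> Proc -> seq (wire R Client Msg * R) :=
  fun p q =>
    if incoming e is Some (p', q', _) then
      if (p == p') && (q == q') then behead (l p q) else l p q
    else l p q.

Definition perform (now : R) (g : system) (e : event) :
    system * seq (output R Client Msg) :=
  let l := consume e (links g) in
  match e with
  | Idle => (g, [::])
  | AtServer s e' =>
      let: (st, o) := server_handle f (clock (srv s) now) (servers g s) e' in
      (System [eta servers g with s |-> st] (clients g)
         (foldl (send now (srv s)) l o), o)
  | AtClient c e' =>
      let: (st, o) :=
        client_handle (clock (cli c) now) est eps (clients g c) e' in
      (System (servers g) [eta clients g with c |-> st]
         (foldl (send now (cli c)) l o), o)
  end.

Definition enabled (now : R) (g : system) (e : event) : Prop :=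
  match e with
  | Idle => False
  | AtServer s e' => server_enabled f (clock (srv s) now) (servers g s) e'
  | AtClient c e' => client_enabled f (clients g c) e'
  end.

Definition allowed (now : R) (g : system) (e : event) : Prop :=
  match e with
  | Idle | AtServer _ (DepDecide _ _) | AtClient _ (Broadcast _) => True
  | _ =>
    if incoming e is Some (p, q, w) then ohead (unzip1 (links g p q)) = Some w
    else enabled now g e
  end.

Variable x : run.

Fixpoint state (i : nat) : system :=
  if i is j.+1 then (perform (times x j) (state j) (events x j)).1
  else init_system.

Definition outputs (i : nat) : seq (output R Client Msg) :=
  (perform (times x i) (state i) (events x i)).2.

Definition triggers (s : Server) (o : output R Client Msg) (i : nat) : Prop :=
  (exists e, events x i = AtServer s e) /\
  exists n, onth (outputs i) n = Some o.

Definition dep_proposes (k : key R Client Msg) (s : Server) (v : bool) (i : nat) : Prop :=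
  triggers s (DepPropose k v) i.
Definition dep_decides (k : key R Client Msg) (s : Server) (v : bool) (i : nat) : Prop :=
  events x i = AtServer s (DepDecide k v).

(* The specification of Binary Consensus; all servers are correct. *)
Record binary_consensus (k : key R Client Msg) : Prop := BinaryConsensus {
  dep_integrity : forall s v v' i j,
    dep_decides k s v i -> dep_decides k s v' j -> i = j;
  dep_agreement : forall s s' v v' i j,
    dep_decides k s v i -> dep_decides k s' v' j -> v = v';
  dep_termination :
    (forall s, exists v i, dep_proposes k s v i) ->
    forall s, exists v i, dep_decides k s v i;
  dep_validity : forall s v i,
    dep_decides k s v i -> exists s' j, dep_proposes k s' v j }.

(* State [state i.+1] holds from [times x i] to [times x i.+1].
   Links are reliable, authenticated and FIFO by construction of [links]; time
   never passes the delivery deadline of a message in transit, nor any instant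
   at which a handler is enabled (instantaneous local computation).  As only
   finitely many steps occur in finite time ([run_finite]), each of these
   deliveries and handler executions does happen.  A broadcast reaches every
   server within Delta, so that [run_finite] amounts, up to idle steps, to each
   process delivering finitely many messages in finite time. *)
Record execution : Prop := Execution {
  run_allowed : forall i, allowed (times x i) (state i) (events x i);
  run_monotone : forall i, times x i <= times x i.+1;
  run_finite : forall T, exists i, T < times x i;
  run_delay : forall i p q,
    all (fun wt => times x i.+1 <= wt.2 + Delta) (links (state i.+1) p q);
  run_urgent : forall i e tau,
    times x i <= tau -> tau < times x i.+1 -> ~ enabled tau (state i.+1) e;
  run_dep : forall k, binary_consensus k }.

Definition broadcasts (c : Client) (m : Msg) (i : nat) : Prop :=
  events x i = AtClient c (Broadcast m).

Definition no_rebroadcast : Prop := forall c m i j,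
  broadcasts c m i -> broadcasts c m j -> i = j.

Definition broadcasts_at (c : Client) (m : Msg) (t : R) : Prop :=
  exists i, broadcasts c m i /\ times x i = t.

Definition delivers_by (s : Server) (c : Client) (m : Msg) (T : R) : Prop :=
  exists i, times x i <= T /\ triggers s (TobDeliver c m) i.

End Executions.

Arguments run R Server {dC dM} Client Msg.

(* Main.v *)
(* Every date put on a message exceeds its submission time by more than Delta,
   so all servers receive the message before its date and propose True in the
   corresponding instance: every instance of Blink decides True.  Let k be the
   key of the broadcast message, T its date plus Delta, and consider the last
   state reached by time T, in which no handler is enabled at T.  All
   suggestions for keys dated at most k have arrived, so all these keys are
   decided; each server has beaten at the date of k and that beat has arrived,
   so the lock time is at least this date.  Hence the least unprocessed
   candidate could be processed unless k has been; and k cannot have been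
   overtaken by a larger key, because k is a candidate on every server before
   its date can be locked. *)
Require Import Defs.
From Stdlib Require List.
From mathcomp Require Import all_boot all_order all_algebra.
From mathcomp Require Import finmap reals constructive_ereal.
Set Implicit Arguments.
Unset Strict Implicit.
Unset Printing Implicit Defensive.
Import Order.TTheory GRing.Theory Num.Theory.
Local Open Scope fset_scope.
Local Open Scope ring_scope.

(** * Effect of a single server step on each component of the state *)

Section Handler.
Context {R : realType} {Server : finType} {dC dM : Order.disp_t}.
Context {Client : orderType dC} {Msg : orderType dM}.
Notation state := (server_state R Server Client Msg).
Notation event := (server_event R Server Client Msg).
Notation key := (key R Client Msg).
Context (f : nat) (now : R).
Implicit Types (s : state) (e : event) (k : key).

Definition spots e k : bool :=
  match e with
  | RecvObserve _ k' => k == k'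
  | RecvMessage c m b => k == (c, m, b)
  | _ => false
  end.

(** A [RecvMessage] counts even when its key is already in [proposed], which makes [handle_proposed]
    a plain disjunction; [handle_con_proposals] treats repetitions separately. *)
Definition proposes e k : bool :=
  match e with
  | Expire k' => k == k'
  | RecvMessage c m b => k == (c, m, b)
  | _ => false
  end.

(** Normal form with all case distinctions pushed into the fields: re-adding a key to [observed]
    changes nothing, so this field needs none. *)
Lemma spotE s k : spot f s k =
  (ServerState (blink s) (con_proposals s) (con_decisions s)
     (k |` observed s) (proposed s)
     (if (lock_time f s < k.2%:E)%O then k |` candidates s else candidates s)
     (delivered s) (remote_times s) (decisions s) (last_processed s)
     (if k \in observed s then timers s else k.2 :: timers s),
   if k \in observed s then [::] else [:: SendServers (MObserve k)]).
Proof.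
rewrite /spot; case: (_ < _)%E; case: s => bl cp cd ob pr ca de rt ds lp ti /=.
all: case h: (k \in ob) => //.
all: by rewrite (mem_fset1U h).
Qed.

Lemma spot_output s k o : List.In o (spot f s k).2 -> o = SendServers (MObserve k).
Proof. by rewrite spotE /=; case: ifP => //= _ []. Qed.

Lemma recv_messageE s c m b (k := (c, m, b) : key) :
  server_handle f now s (RecvMessage c m b) =
  if k \in proposed s then spot f s k
  else (con_propose (spot f s k).1 k (now < b), (spot f s k).2).
Proof.
by rewrite /= -/k spotE /=; case: ifP.
Qed.

Lemma handle_observed s e k :
  (k \in observed (server_handle f now s e).1) =
  spots e k || (k \in observed s).
Proof.
case: e => [p k' v|p t|p k'|c m b|k' v|k' v|k' v|k' v|k' v|b|k'|k'];
  rewrite ?recv_messageE /= ?spotE /con_decide /Defs.order; case: s => *;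
  rewrite /= -?in_fset1U //.
all: by do ?[case: ifP].
Qed.

Lemma handle_candidates s e k :
  (k \in candidates (server_handle f now s e).1) =
  (spots e k && (lock_time f s < k.2%:E)%O) || (k \in candidates s).
Proof.
case: e => [p k' v|p t|p k'|c m b|k' v|k' v|k' v|k' v|k' v|b|k'|k'];
  rewrite ?recv_messageE /= ?spotE /con_decide /Defs.order.
3: by rewrite /=; case: (k =P k') => [->|/eqP/negPf h] //; case: ifP;
  rewrite ?in_fset1U ?eqxx ?h.
3: by case: ifP => _ /=; case: (k =P _) => [->|/eqP/negPf h] //; case: ifP;
  rewrite ?in_fset1U ?eqxx ?h.
all: case: s => * //=.
all: by do ?[case: ifP].
Qed.

Lemma handle_proposed s e k :
  (k \in proposed (server_handle f now s e).1) =
  proposes e k || (k \in proposed s).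
Proof.
case: e => [p k' v|p t|p k'|c m b|k' v|k' v|k' v|k' v|k' v|b|k'|k'];
  rewrite ?recv_messageE /= ?spotE /con_decide /Defs.order; case: s => *;
  rewrite /= ?in_fset1U //.
1: by case: ifP => h; rewrite ?in_fset1U //; case: (k =P _) => // ->.
all: by do ?[case: ifP].
Qed.

(** The clause about [proposed] records that a repeated message proposes nothing. [Expire] alone
    adds a proposal without testing [proposed] in its body, since its guard already does. *)
Lemma handle_con_proposals s e k v :
  (k, v) \in con_proposals (server_handle f now s e).1 ->
  (k, v) \in con_proposals s \/
  [/\ proposes e k, k \in proposed s -> e = Expire k &
      v = if e is Expire _ then false else now < k.2].
Proof.
case: e => [p k' v'|p t|p k'|c m b|k' v'|k' v'|k' v'|k' v'|k' v'|b|k'|k'];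
  rewrite ?recv_messageE /= ?spotE /con_decide /Defs.order;
  case: s => bl cp cd ob pr ca de rt ds lp ti /=;
  try by left.
all: do ?[case: ifP => ? /=]; rewrite ?inE; try by left.
- case/orP=> [/eqP[-> ->]|]; last by left.
  by right; split=> //; congruence.
- by move/mem_rem; left.
- by case/orP=> [/eqP[-> ->]|]; [right|left].
Qed.

Lemma handle_con_proposals_new s e k :
  k \in proposed (server_handle f now s e).1 -> k \notin proposed s ->
  exists v, (k, v) \in con_proposals (server_handle f now s e).1.
Proof.
move=> + /negPf h; rewrite handle_proposed h orbF.
case: e => // [c m b|k']; rewrite ?recv_messageE [proposes _ _]/= => /eqP <-.
- by rewrite h; exists (now < b); rewrite spotE /= inE eqxx.
- by exists false; case: s {h} => * /=; rewrite inE eqxx.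
Qed.

Lemma handle_con_proposals_kept s e k v :
  (k, v) \in con_proposals s ->
  (k, v) \in con_proposals (server_handle f now s e).1 \/ e = HandlePropose k v.
Proof.
move=> h.
case: e => [p k' v'|p t|p k'|c m b|k' v'|k' v'|k' v'|k' v'|k' v'|b|k'|k'];
  rewrite ?recv_messageE /= ?spotE /con_decide /Defs.order;
  case: s h => bl cp cd ob pr ca de rt ds lp ti h /=;
  try by left.
all: do ?[case: ifP => ? /=]; rewrite ?inE ?h ?orbT; try by left.
case: ((k, v) =P (k', v')) => [[-> ->]|/eqP n]; first by right.
by left; rewrite rem_mem.
Qed.

Lemma handle_con_decisions s e k v :
  (k, v) \in con_decisions (server_handle f now s e).1 ->
  [\/ (k, v) \in con_decisions s, e = DepDecide k v | e = QuorumDecide k v].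
Proof.
case: e => [p k' v'|p t|p k'|c m b|k' v'|k' v'|k' v'|k' v'|k' v'|b|k'|k'];
  rewrite ?recv_messageE /= ?spotE /con_decide /Defs.order;
  case: s => bl cp cd ob pr ca de rt ds lp ti /=;
  do ?[case: ifP => ? /=]; rewrite ?inE;
  try by constructor 1.
- by case/orP=> [/eqP[-> ->]|]; [constructor 2|constructor 1].
- by move/mem_rem; constructor 1.
- by case/orP=> [/eqP[-> ->]|]; [constructor 3|constructor 1].
Qed.

Lemma handle_decisions s e k :
  decisions (server_handle f now s e).1 k =
  if e is HandleDecide k' v then if k == k' then Some v else decisions s k
  else decisions s k.
Proof.
case: e => [p k' v'|p t|p k'|c m b|k' v'|k' v'|k' v'|k' v'|k' v'|b|k'|k'];
  rewrite ?recv_messageE /= ?spotE /con_decide /Defs.order; case: s => * //=;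
  by do ?[case: ifP => ? /=].
Qed.

Lemma handle_con_decisions_kept s e k v :
  (k, v) \in con_decisions s ->
  (k, v) \in con_decisions (server_handle f now s e).1 \/ e = HandleDecide k v.
Proof.
move=> h.
case: e => [p k' v'|p t|p k'|c m b|k' v'|k' v'|k' v'|k' v'|k' v'|b|k'|k'];
  rewrite ?recv_messageE /= ?spotE /con_decide /Defs.order;
  case: s h => bl cp cd ob pr ca de rt ds lp ti h /=;
  try by left.
all: do ?[case: ifP => ? /=]; rewrite ?inE ?h ?orbT; try by left.
case: ((k, v) =P (k', v')) => [[-> ->]|/eqP n]; first by right.
by left; rewrite rem_mem.
Qed.

Lemma handle_decided s e k :
  decided (blink (server_handle f now s e).1 k) ->
  decided (blink s k) \/
  exists v, (k, v) \in con_decisions (server_handle f now s e).1.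
Proof.
case: e => [p k' v'|p t|p k'|c m b|k' v'|k' v'|k' v'|k' v'|k' v'|b|k'|k'];
  rewrite ?recv_messageE /= ?spotE /con_decide /Defs.order;
  case: s => bl cp cd ob pr ca de rt ds lp ti /=;
  try by left.
all: try by do ?[case: ifP => _ //=]; left.
all: try by case: eqP => [->|_]; left.
all: case: ifP => _ /=; first by left.
all: case: eqP => [->|_]; last by left.
all: by right; exists v'; rewrite inE eqxx.
Qed.

Lemma handle_suggestions s e k p :
  suggestions (blink (server_handle f now s e).1 k) p =
  if e is RecvSuggest p' k' v then
    if (k == k') && (p == p') then Some v else suggestions (blink s k) p
  else suggestions (blink s k) p.
Proof.
case: e => [p' k' v'|p' t|p' k'|c m b|k' v'|k' v'|k' v'|k' v'|k' v'|b|k'|k'];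
  rewrite ?recv_messageE /= ?spotE /con_decide /Defs.order; case: s => * //=;
  try by do ?[case: ifP => _ /=].
1: by case: eqP => [->|_] //=; rewrite ffunE.
all: try by case: eqP => [->|].
all: by case: ifP => _ //=; case: eqP => [->|].
Qed.

Lemma handle_remote_times s e p :
  remote_times (server_handle f now s e).1 p =
  if e is RecvTime p' t then
    if p == p' then Order.max (remote_times s p) t%:E else remote_times s p
  else remote_times s p.
Proof.
case: e => [p' k' v'|p' t|p' k'|c m b|k' v'|k' v'|k' v'|k' v'|k' v'|b|k'|k'];
  rewrite ?recv_messageE /= ?spotE /con_decide /Defs.order; case: s => * //=;
  try by do ?[case: ifP => ? //=].
by rewrite ffunE.
Qed.

(** Several keys may share the date [b]. It does not matter whose timer [Beat b] removes, since a
    beat at [b] serves all of them. *)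
Lemma handle_timers_kept s e b :
  b \in timers s -> b \in timers (server_handle f now s e).1 \/ e = Beat b.
Proof.
move=> h.
case: e => [p k' v'|p t|p k'|c m b'|k' v'|k' v'|k' v'|k' v'|k' v'|b'|k'|k'];
  rewrite ?recv_messageE /= ?spotE /con_decide /Defs.order;
  case: s h => bl cp cd ob pr ca de rt ds lp ti h /=;
  do ?[case: ifP => ? /=]; rewrite ?inE ?h ?orbT; try by left.
case: (b =P b') => [->|/eqP n]; first by right.
by left; rewrite rem_mem.
Qed.

Lemma handle_timers_new s e k :
  spots e k -> k \notin observed s ->
  k.2 \in timers (server_handle f now s e).1.
Proof.
case: e => // [p k'|c m b]; rewrite ?recv_messageE [spots _ _]/= => /eqP <- /negPf h.
- by rewrite /= spotE h /= inE eqxx.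
- by rewrite /= spotE h /=; case: ifP => _ /=; rewrite inE eqxx.
Qed.

Lemma handle_delivered s e c m :
  (c, m) \in delivered (server_handle f now s e).1 ->
  (c, m) \in delivered s \/
  (server_handle f now s e).2 = [:: TobDeliver c m].
Proof.
case: e => [p' k' v'|p' t|p' k'|c' m' b|k' v'|k' v'|k' v'|k' v'|k' v'|b|k'|k'];
  rewrite ?recv_messageE /= ?spotE /con_decide /Defs.order;
  case: s => bl cp cd ob pr ca de rt ds lp ti /=;
  do ?[case: ifP => ? /=]; try by left.
by rewrite in_fset1U => /orP[/eqP[-> ->]|]; [right|left].
Qed.

Lemma handle_delivered_kept s e c m :
  (c, m) \in delivered s -> (c, m) \in delivered (server_handle f now s e).1.
Proof.
move=> h.
case: e => [p' k' v'|p' t|p' k'|c' m' b|k' v'|k' v'|k' v'|k' v'|k' v'|b|k'|k'];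
  rewrite ?recv_messageE /= ?spotE /con_decide /Defs.order;
  case: s h => bl cp cd ob pr ca de rt ds lp ti h //=;
  do ?[case: ifP => ? /=] => //.
by rewrite in_fset1U h orbT.
Qed.

Lemma process_delivered s k :
  decisions s k = Some true ->
  (k.1.1, k.1.2) \in delivered (server_handle f now s (Process k)).1.
Proof.
move=> /= ->; rewrite eqxx /Defs.order; case: ifP => h; case: s h => bl cp cd ob pr ca de rt ds lp ti h //=.
by rewrite in_fset1U eqxx.
Qed.

Lemma handle_last_processed s e :
  last_processed (server_handle f now s e).1 =
  if e is Process k then Some k else last_processed s.
Proof.
case: e => [p' k' v'|p' t|p' k'|c' m' b|k' v'|k' v'|k' v'|k' v'|k' v'|b|k'|k'];
  rewrite ?recv_messageE /= ?spotE /con_decide /Defs.order; case: s => * //=;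
  by do ?[case: ifP => ? /=].
Qed.
End Handler.

(** * Outputs of a step, read back to the event that produced them *)

Section Outputs.
Context {R : realType} {Server : finType} {dC dM : Order.disp_t}.
Context {Client : orderType dC} {Msg : orderType dM}.
Context (f : nat) (now : R).
Implicit Types (s : server_state R Server Client Msg).
Implicit Types (e : server_event R Server Client Msg) (o : output R Client Msg).

Lemma handle_output s e o : List.In o (server_handle f now s e).2 ->
  match o with
  | SendServers (MSuggest k v) => e = HandlePropose k v
  | SendServers (MTime t) => t = now
  | SendServers (MObserve k) => spots e k
  | SendServers _ => False
  | SendClient _ w => if w is MDecision _ _ _ then True else False
  | DepPropose k v => e = QuorumPropose k v
  | TobDeliver _ _ => True
  end.
Proof.
case: e => [p k v|p t|p k|c m b|k v|k v|k v|k v|k v|b|k|k];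
  rewrite ?recv_messageE /=; try by case=> // <-.
- by move/spot_output=> -> /=.
- by case: ifP => _ /spot_output ->.
- by case: ifP => _ //; rewrite /Defs.order; case: ifP => _ //= [<-|].
Qed.

Lemma client_output (est eps : R) (s : client_state R Server Msg)
    (e : client_event R Server Msg) o :
  List.In o (client_handle now est eps s e).2 ->
  exists m r, o = SendServers (MMessage m (now + 2 ^+ r * est + eps)) :> output R Client Msg.
Proof.
case: e => //= [m [<-|//]|m]; first by exists m, 0%N.
by case: (submissions s m) => //= -[r _] [<-|//]; exists m, r.+1.
Qed.
End Outputs.

(** * Messages in transit under sending and consumption *)

Section Links.
Context {R : realType} {Server : finType} {dC dM : Order.disp_t}.
Context {Client : orderType dC} {Msg : orderType dM} {Proc : eqType}.
Context (srv : Server -> Proc) (cli : Client -> Proc).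
Implicit Types (l : Proc -> Proc -> seq (wire R Client Msg * R)).

Lemma In_rcons T (y z : T) s : List.In y (rcons s z) <-> List.In y s \/ y = z.
Proof.
elim: s => [|a s ih] /=; first by split=> [[->|//]|[//|->]]; [right|left].
by rewrite ih or_assoc.
Qed.

Lemma In_foldl_send now p0 l os p q y :
  List.In y (foldl (send srv cli now p0) l os p q) <->
  List.In y (l p q) \/ [/\ p = p0, y.2 = now & exists o dst,
    [/\ List.In o os, recipient srv cli o = Some (dst, y.1) & dst q]].
Proof.
elim: os l => [|o os ih] l /=.
  by split=> [|[//|[_ _ [o [dst [[]]]]]]]; left.
rewrite ih; split=> [[h|[-> h2 [o' [dst [h3 h4 h5]]]]]|].
- move: h; rewrite {1}/send; case E: (recipient srv cli o) => [[dst w]|]; last by left.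
  case: ifP => [/andP[/eqP -> h]|_]; last by left.
  case/In_rcons => [|->]; first by left.
  by right; split=> //; exists o, dst; split=> //; left.
- by right; split=> //; exists o', dst; split=> //; right.
- case=> [h|[-> h2 [o' [dst [[<-|h3] h4 h5]]]]].
  + left; rewrite /send; case: (recipient _ _ _) => [[dst w]|//].
    by case: ifP => // _; apply/In_rcons; left.
  + left; rewrite /send h4 eqxx h5 /=; apply/In_rcons; right.
    by rewrite -h2; case: (y).
  + by right; split=> //; exists o', dst.
Qed.

Lemma In_consume (e : @event R Server dC dM Client Msg) l p q y :
  List.In y (consume srv cli e l p q) -> List.In y (l p q).
Proof.
rewrite /consume; case: incoming => [[[p' q'] _]|//].
by case: ifP => // _; case: (l p q) => //= a r h; right.
Qed.

(** [consume] drops the head of the link without looking at its content. A message that disappears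
    is therefore the head, which [incoming_head] identifies with the delivered one. *)
Lemma consume_kept (e : @event R Server dC dM Client Msg) l p q y :
  List.In y (l p q) -> List.In y (consume srv cli e l p q) \/
  exists w, incoming srv cli e = Some (p, q, w) /\
    ohead (unzip1 (l p q)) = Some y.1.
Proof.
move=> h; rewrite /consume; case E: incoming => [[[p' q'] w]|]; last by left.
case: ifP => [/andP[/eqP <- /eqP <-]|_]; last by left.
move: h; case: (l p q) => //= a r [->|h]; last by left.
by right; exists w.
Qed.
End Links.

(** * Time, links and server steps in a good-case execution *)

Section Execution.
Context {R : realType} {f : nat} {Server : finType} {dC dM : Order.disp_t}.
Context {Client : orderType dC} {Msg : orderType dM} {Proc : eqType}.
Context {srv : Server -> Proc} {cli : Client -> Proc} {Delta eps : R}.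
Context {clock : Proc -> R -> R} {x : run R Server Client Msg}.
Context (srv_inj : injective srv) (cli_inj : injective cli).
Context (Delta_gt0 : 0 < Delta) (eps_gt0 : 0 < eps).
Context (clock_exact : forall (p : Proc) (tau : R), clock p tau = tau).
Context (x_exec : execution f srv cli Delta Delta eps clock x).
Notation key := (key R Client Msg).
Notation st i := (state f srv cli Delta eps clock x i).
Notation out i := (outputs f srv cli Delta eps clock x i).
Notation srv_st i s := (servers (st i) s).
Notation tm := (times x).
Implicit Types (k : key) (s : Server) (i j : nat).

Lemma times_le i j : (i <= j)%N -> tm i <= tm j.
Proof.
move=> /subnKC <-; elim: (_ - _)%N => [|n ih]; first by rewrite addn0.
by rewrite addnS; apply: le_trans ih (run_monotone x_exec _).
Qed.

Lemma times_lt i j : tm i < tm j -> (i < j)%N.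
Proof. by rewrite ltnNge; apply: contraTN => /times_le h; rewrite -leNgt. Qed.

(** [run_finite] gives a first index after [T], and its predecessor is the last step by [T]. Several
    steps may share a time, and all those at [T] are then behind. *)
Lemma last_step (T : R) : tm 0 <= T -> exists j, tm j <= T < tm j.+1.
Proof.
move=> h0; have [n hn] := run_finite x_exec T.
have [i hi imin] := ex_minnP (ex_intro (fun n => T < tm n) n hn).
case: i hi imin => [|j] hj jmin; first by rewrite ltNge h0 in hj.
exists j; rewrite hj andbT leNgt; apply/negP => /jmin.
by rewrite ltnn.
Qed.

Definition sender (e : @event R Server dC dM Client Msg) : option Proc :=
  match e with
  | Idle => None
  | AtServer s _ => Some (srv s)
  | AtClient c _ => Some (cli c)
  end.

Definition sent p q w i : Prop := sender (events x i) = Some p /\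
  exists o dst, [/\ List.In o (out i), recipient srv cli o = Some (dst, w) & dst q].

Lemma linksE i p q : links (st i.+1) p q =
  if sender (events x i) is Some p0 then
    foldl (send srv cli (tm i) p0)
      (consume srv cli (events x i) (links (st i))) (out i) p q
  else links (st i) p q.
Proof.
rewrite /outputs /=; case: (events x i) => //= [s e|c e].
- by case: (server_handle _ _ _ _).
- by case: (client_handle _ _ _ _).
Qed.

Lemma In_links_step i p q y : List.In y (links (st i.+1) p q) ->
  List.In y (links (st i) p q) \/ sent p q y.1 i /\ y.2 = tm i.
Proof.
rewrite linksE /sent; case: sender => [p0|]; last by left.
case/In_foldl_send => [/In_consume|[-> h2 [o [dst h]]]]; first by left.
by right; split=> //; split=> //; exists o, dst.
Qed.

Lemma sent_links i p q w : sent p q w i -> List.In (w, tm i) (links (st i.+1) p q).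
Proof.
by case=> h1 h2; rewrite linksE h1; apply/In_foldl_send; right.
Qed.

Lemma links_sent i p q y : List.In y (links (st i) p q) ->
  exists2 j, (j < i)%N & sent p q y.1 j /\ y.2 = tm j.
Proof.
elim: i => [//|i ih] /In_links_step [/ih [j hj h]|h].
  by exists j => //; apply: ltnW.
by exists i.
Qed.

Lemma incoming_head i p q w : incoming srv cli (events x i) = Some (p, q, w) ->
  ohead (unzip1 (links (st i) p q)) = Some w.
Proof.
move=> h; have := run_allowed x_exec i; rewrite /allowed h.
by case: (events x i) h => // [s|c] [].
Qed.

Lemma incoming_sent i p q w : incoming srv cli (events x i) = Some (p, q, w) ->
  exists2 j, (j < i)%N & sent p q w j.
Proof.
move/incoming_head; case E: (links _ _ _) => [|y l] //= [hy].
have /links_sent [j hj [h _]] : List.In y (links (st i) p q) by rewrite E; left.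
by exists j => //; rewrite -hy.
Qed.

Lemma links_kept i p q y : List.In y (links (st i) p q) ->
  List.In y (links (st i.+1) p q) \/ incoming srv cli (events x i) = Some (p, q, y.1).
Proof.
move=> h; have [h'|[w [hw]]] := consume_kept srv cli (events x i) h.
  left; rewrite linksE; case: sender => // p0.
  by apply/In_foldl_send; left.
by rewrite (incoming_head hw) => -[<-]; right.
Qed.

Lemma links_deadline i p q y :
  List.In y (links (st i) p q) -> tm i <= y.2 + Delta.
Proof.
case: i => [//|i] h; have := run_delay x_exec i p q.
elim: (links _ p q) h => //= a l ih [->|h] /andP[] //.
by move=> _; apply: ih.
Qed.

Lemma server_stepE i s e : events x i = AtServer s e ->
  srv_st i.+1 s = (server_handle f (tm i) (srv_st i s) e).1.
Proof.
by move=> /= ->; rewrite /= clock_exact; case: (server_handle _ _ _ _) => ? ? /=;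
  rewrite eqxx.
Qed.

Lemma server_outE i s e : events x i = AtServer s e ->
  out i = (server_handle f (tm i) (srv_st i s) e).2.
Proof.
by rewrite /outputs => -> /=; rewrite clock_exact; case: (server_handle _ _ _ _).
Qed.

Lemma server_step i s : srv_st i.+1 s = srv_st i s \/
  exists e, events x i = AtServer s e /\
    srv_st i.+1 s = (server_handle f (tm i) (srv_st i s) e).1.
Proof.
case E: (events x i) => [|s' e|c e]; first by left; rewrite /= E.
- have [->|/eqP n] := eqVneq s s'.
    by right; exists e; split=> //; apply: server_stepE.
  by left; rewrite /= E /=; case: (server_handle _ _ _ _) => ? ? /=; case: eqP.
- by left; rewrite /= E /=; case: (client_handle _ _ _ _).
Qed.

Lemma server_guard i s e : events x i = AtServer s e ->
  match e with
  | RecvSuggest _ _ _ | RecvTime _ _ | RecvObserve _ _ | RecvMessage _ _ _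
  | DepDecide _ _ => True
  | _ => server_enabled f (tm i) (srv_st i s) e
  end.
Proof.
move=> h; have := run_allowed x_exec i; rewrite /allowed h.
by case: e {h} => /=; rewrite ?clock_exact.
Qed.

(** Urgency only forces some step to occur by [T], not that of [e] itself. The progress lemmas below
    hence carry a pending item through arbitrary other steps. *)
Lemma urgent i s e (T : R) : server_enabled f T (srv_st i.+1 s) e ->
  tm i <= T -> tm i.+1 <= T.
Proof.
move=> he hi; rewrite leNgt; apply/negP => hT.
have h : enabled f srv clock T (st i.+1) (AtServer s e) by rewrite /= clock_exact.
exact: (run_urgent x_exec hi hT h).
Qed.

(** * Submissions, by broadcast or retry, as the origin of all keys *)

Definition submitted k i : Prop :=
  (exists e, events x i = AtClient k.1.1 e) /\
  List.In (SendServers (MMessage k.1.2 k.2)) (out i).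

(** The date is [tm i + 2 ^+ r * Delta + eps] with [2 ^+ r >= 1]; the margin [eps] makes the
    inequality strict. *)
Lemma submitted_deadline k i : submitted k i -> tm i + Delta < k.2.
Proof.
case=> -[e h]; rewrite /outputs h /=.
case E: (client_handle _ _ _ _) => [c o] /= hin.
have /client_output [m [r [_ ->]]] :
  List.In (SendServers (MMessage k.1.2 k.2) : output R Client Msg)
    (client_handle (clock (cli k.1.1) (tm i)) Delta eps (clients (st i) k.1.1) e).2.
  by rewrite E.
rewrite clock_exact -addrA ltrD2l.
apply: (@le_lt_trans _ _ (2 ^+ r * Delta)); last by rewrite ltrDl.
by apply: ler_peMl; [exact: ltW|rewrite exprn_ege1 ?ler1n].
Qed.

(** A process may be both a server and a client, so the sender alone does not tell which algorithm
    sent the message; the constructor of the message does. *)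
Lemma sent_inv p q w i : sent p q w i ->
  match w with
  | MSuggest k v =>
      exists2 s, p = srv s & events x i = AtServer s (HandlePropose k v)
  | MTime t => t = tm i
  | MObserve k => exists s e, events x i = AtServer s e /\ spots e k
  | MMessage m b => exists2 c, p = cli c & submitted (c, m, b) i
  | MDecision _ _ _ => True
  end.
Proof.
case=> h [o [dst [ho hr _]]].
case E: (events x i) h => [//|s e|c e] [hp].
- have {}ho : List.In o (server_handle f (tm i) (srv_st i s) e).2.
    by rewrite -(server_outE E).
  move/handle_output: ho hr; case: o => //= [w' h [_ <-]|c w' h [_ <-]].
    case: w' h => //= [k v <-|k h]; first by exists s.
    by exists s, e.
  by case: w' h.
- have {}ho' : List.In o (client_handle (tm i) Delta eps (clients (st i) c) e).2.
    move: ho; rewrite /outputs E /= clock_exact.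
    by case: (client_handle _ _ _ _).
  have [m [r eo]] := client_output ho'; move: hr; rewrite eo => -[_ <-].
  exists c; first by rewrite hp.
  by split; [exists e|rewrite -eo].
Qed.

Lemma recv_suggest_inv i s p k v : events x i = AtServer s (RecvSuggest p k v) ->
  exists2 j, (j < i)%N & events x j = AtServer p (HandlePropose k v).
Proof.
move=> h; have : incoming srv cli (events x i) = Some (srv p, srv s, MSuggest k v).
  by rewrite h.
by case/incoming_sent => j hj /sent_inv [p' /srv_inj <-]; exists j.
Qed.

Lemma recv_time_inv i s p t : events x i = AtServer s (RecvTime p t) -> t <= tm i.
Proof.
move=> h; have : incoming srv cli (events x i) = Some (srv p, srv s, MTime t).
  by rewrite h.
by case/incoming_sent => j hj /sent_inv ->; apply/times_le/ltnW.
Qed.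

Lemma spots_submitted i s e k : events x i = AtServer s e -> spots e k ->
  exists2 j, (j < i)%N & submitted k j.
Proof.
(* Strong induction on the step: an [MObserve] stems from an earlier spotting at another server, and
   this chain can only start with a message from the client. *)
have [n] := ubnP i; elim: n i s e => // n ih i s e /ltnSE hi h.
case: e h => //= [p k' h|c m b h] /eqP ek; subst k.
- have : incoming srv cli (events x i) = Some (srv p, srv s, MObserve k').
    by rewrite h.
  case/incoming_sent => j hj /sent_inv [s' [e' [h1 h2]]].
  have [j' hj' hs] := ih _ _ _ (leq_trans hj hi) h1 h2.
  by exists j' => //; apply: ltn_trans hj.
- have : incoming srv cli (events x i) = Some (cli c, srv s, MMessage m b).
    by rewrite h.
  case/incoming_sent => j hj /sent_inv [c' /cli_inj <- hs].
  by exists j.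
Qed.

Lemma observed_submitted i s k : k \in observed (srv_st i s) ->
  exists2 j, (j < i)%N & submitted k j.
Proof.
elim: i => [|i ih]; first by rewrite inE.
case: (server_step i s) => [->|[e [h ->]]].
  by case/ih => j hj hs; exists j => //; apply: ltnW.
rewrite handle_observed => /orP[/(spots_submitted h)|/ih] [j hj hs];
  by exists j => //; apply: ltnW.
Qed.

Lemma candidates_submitted i s k : k \in candidates (srv_st i s) ->
  exists2 j, (j < i)%N & submitted k j.
Proof.
elim: i => [|i ih]; first by rewrite inE.
case: (server_step i s) => [->|[e [h ->]]].
  by case/ih => j hj hs; exists j => //; apply: ltnW.
rewrite handle_candidates => /orP[/andP[/(spots_submitted h)[j hj hs] _]|/ih[j hj hs]];
  by exists j => //; apply: ltnW.
Qed.

Lemma proposes_submitted i s e k : events x i = AtServer s e -> proposes e k ->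
  exists2 j, (j < i)%N & submitted k j.
Proof.
case: e => // [c m b|k'] h; first exact: spots_submitted h.
by move/eqP=> ->; have [/observed_submitted] := server_guard h.
Qed.

(** * Lock times, and registration of keys before their dates *)

Lemma remote_times_le i s p : (remote_times (srv_st i s) p <= (tm i)%:E)%O.
Proof.
elim: i => [|i ih]; first by rewrite ffunE leNye.
have {}ih : (remote_times (srv_st i s) p <= (tm i.+1)%:E)%O.
  by apply: le_trans ih _; rewrite lee_fin times_le.
case: (server_step i s) => [->//|[e [h ->]]].
rewrite handle_remote_times; case: e h => // p' t h.
case: ifP => // _; rewrite ge_max ih /= lee_fin.
exact: le_trans (recv_time_inv h) (times_le (leqnSn i)).
Qed.

(** Beats carry exact clock readings made before their delivery, so the lock time never runs ahead
    of real time. *)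
Lemma lock_time_le i s : (lock_time f (srv_st i s) <= (tm i)%:E)%O.
Proof.
rewrite /lock_time; apply: (big_ind (fun t => t <= (tm i)%:E)%O).
- exact: leNye.
- by move=> a b ha hb; rewrite ge_max ha.
- by move=> p _; apply: remote_times_le.
Qed.

(** What a timely receipt of the client's message achieves at once; no handler ever removes elements
    from these three sets. *)
Definition registered k (s : server_state R Server Client Msg) : bool :=
  [&& k \in observed s, k \in proposed s & k \in candidates s].

Lemma registered_step i s k :
  registered k (srv_st i s) -> registered k (srv_st i.+1 s).
Proof.
case/and3P=> h1 h2 h3; case: (server_step i s) => [->|[e [_ ->]]].
  exact/and3P.
by apply/and3P; rewrite handle_observed handle_proposed handle_candidates h1 h2 h3 !orbT.
Qed.

Lemma submitted_sent k i s : submitted k i ->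
  sent (cli k.1.1) (srv s) (MMessage k.1.2 k.2) i.
Proof.
case=> -[e h] ho; split; first by rewrite h.
exists (SendServers (MMessage k.1.2 k.2)), (fun q => q \in codom srv); split=> //.
exact: codom_f.
Qed.

(* A message reaches every server within [Delta], thus strictly before its date
   [k.2], when no server can have locked that date. *)
Lemma registered_by k i0 i s : submitted k i0 -> k.2 <= tm i ->
  registered k (srv_st i s).
Proof.
move=> hk hi; have dl := submitted_deadline hk.
have i0i : (i0 < i)%N.
  by apply/times_lt/(lt_le_trans _ hi)/(le_lt_trans _ dl); rewrite lerDl ltW.
(* Invariant from the submission on: the message is in transit or the key is registered. The delay
   bound rules out the former once the date is reached. *)
suff [h|//] : List.In (MMessage k.1.2 k.2, tm i0)
    (links (st i) (cli k.1.1) (srv s)) \/ registered k (srv_st i s).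
  by have := le_trans hi (links_deadline h); rewrite leNgt dl.
move: i0i {hi}; elim: i => // i ih; rewrite ltnS leq_eqVlt => /orP[/eqP <-|/ih].
  by left; apply/sent_links/submitted_sent.
case=> [h|/registered_step]; last by right.
have [h'|hin] := links_kept h; [by left|right].
have ev : events x i = AtServer s (RecvMessage k.1.1 k.1.2 k.2).
  case: (events x i) hin => // [s' [] //= p|c [] //= p m b v [_ _]] //.
  by move=> m b [/cli_inj -> /srv_inj -> -> ->].
rewrite /registered (server_stepE ev) handle_observed handle_proposed handle_candidates /=.
rewrite -!surjective_pairing eqxx /=.
apply/orP; left; apply: le_lt_trans (lock_time_le i s) _.
by rewrite lte_fin; apply: le_lt_trans (links_deadline h) dl.
Qed.

(** * All values handled by Blink are True *)

Lemma con_proposals_true i s k v : (k, v) \in con_proposals (srv_st i s) -> v.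
Proof.
elim: i => [//|i ih]; case: (server_step i s) => [->//|[e [he ->]]].
case/handle_con_proposals => [/ih //|[pe hp ->]].
(* Before the date, [Expire] is disabled and a message proposes True. From the date on, the key is
   registered, hence already proposed, so only [Expire] could propose again, and its guard forbids
   it. *)
have [j hj hk] := proposes_submitted he pe.
have [hi|hi] := leP k.2 (tm i); last first.
  case: e he pe {hp} => // k' /server_guard[_ _ hb] /eqP ek.
  by rewrite -ek leNgt hi in hb.
have /and3P[_ kp _] := registered_by s hk hi.
by move: he; rewrite (hp kp) => /server_guard []; rewrite kp.
Qed.

Lemma suggestions_true i s k p v :
  suggestions (blink (srv_st i s) k) p = Some v -> v.
Proof.
elim: i => [|i ih]; first by rewrite ffunE.
case: (server_step i s) => [->//|[e [he ->]]].
rewrite handle_suggestions; case: e he => // p' k' v' he.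
case: ifP => // _ [<-]; have [j _ hj] := recv_suggest_inv he.
exact: con_proposals_true (server_guard hj).
Qed.

Lemma support_true i s k v :
  (0 < Defs.support (blink (srv_st i s) k) v)%N -> v.
Proof. by case/card_gt0P => p; rewrite inE => /eqP /suggestions_true. Qed.

Lemma onth_In T (l : seq T) n y : onth l n = Some y -> List.In y l.
Proof.
by elim: l n => [[]|a l ih [[->]|n /ih]] //=; [left|right].
Qed.

(** Validity leads back to a [DepPropose], whose guard asks for [2 * f + 1] suggestions of [v]; this
    quorum is nonempty, and every suggestion is True. *)
Lemma dep_decides_true k s v i : dep_decides x k s v i -> v.
Proof.
move=> h; have [s' [j [[e he] [n hn]]]] := dep_validity (run_dep x_exec k) h.
move: (onth_In hn); rewrite (server_outE he) => /handle_output ee; rewrite ee in he.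
have [_ _ hs] := server_guard he; apply: support_true (leq_trans _ hs).
by rewrite addn1.
Qed.

Lemma con_decisions_true i s k v : (k, v) \in con_decisions (srv_st i s) -> v.
Proof.
elim: i => [//|i ih]; case: (server_step i s) => [->//|[e [he ->]]].
case/handle_con_decisions => [/ih //|ee|ee]; rewrite ee in he.
  exact: dep_decides_true he.
have [hs _] := server_guard he; apply: support_true (leq_trans _ hs).
by rewrite addn1.
Qed.

Lemma decisions_true i s k v : decisions (srv_st i s) k = Some v -> v.
Proof.
elim: i => [//|i ih]; case: (server_step i s) => [->//|[e [he ->]]].
rewrite handle_decisions; case: e he => // k' v' he; case: eqP => // _ [<-].
exact: con_decisions_true (server_guard he).
Qed.

(** * Progress of suggestions, beats and decisions *)

Lemma event_sent i s e w s' : events x i = AtServer s e ->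
  List.In (SendServers w) (server_handle f (tm i) (srv_st i s) e).2 ->
  sent (srv s) (srv s') w i.
Proof.
move=> he ho; split; first by rewrite he.
exists (SendServers w), (fun q => q \in codom srv); rewrite (server_outE he).
by split=> //; apply: codom_f.
Qed.

(** The three stages of a suggestion: pending, in transit, received. The time bounds make the first
    impossible after [k.2] and the second after [k.2 + Delta]. *)
Lemma suggest_progress k i s s' : k \in proposed (srv_st i s) ->
  [\/ (k, true) \in con_proposals (srv_st i s) /\ tm i <= k.2,
      exists2 t, t <= k.2 &
        List.In (MSuggest k true, t) (links (st i) (srv s) (srv s'))
    | suggestions (blink (srv_st i s') k) s = Some true].
Proof.
elim: i => [|i ih]; first by rewrite inE.
(* The handler of a pending proposal is enabled at every time, in particular at [k.2]; urgency there
   extends the bound to the next step. *)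
have pending v : (k, v) \in con_proposals (srv_st i.+1 s) -> tm i <= k.2 ->
    (k, true) \in con_proposals (srv_st i.+1 s) /\ tm i.+1 <= k.2.
  move=> h hi; move: (con_proposals_true h) (h) => -> h'; split=> //.
  exact: (@urgent _ _ (HandlePropose k true) _ h').
case: (boolP (k \in proposed (srv_st i s))) => [/ih {}ih _|kn].
  case: ih => [[kc hi]|[t ht hin]|hs].
  - case: (server_step i s) => [e|[e [he ee]]].
      by constructor 1; apply: (pending true); rewrite ?e.
    have [h|ep] := handle_con_proposals_kept f (tm i) e kc.
      by constructor 1; apply: (pending true); rewrite ?ee.
    constructor 2; exists (tm i) => //; apply/sent_links/(event_sent _ he).
    by rewrite ep; left.
  - have [h|hin'] := links_kept hin; first by constructor 2; exists t.
    have ev : events x i = AtServer s' (RecvSuggest s k true).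
      case: (events x i) hin' => // [s1 [] //= p|c [] //= p m b v [_ _]] //.
      by move=> k' v [/srv_inj -> /srv_inj -> -> ->].
    by constructor 3; rewrite (server_stepE ev) handle_suggestions !eqxx.
  (* A later suggestion from [s] may overwrite this one, but only with True again. *)
  - constructor 3; case: (server_step i s') => [-> //|[e [he ->]]].
    rewrite handle_suggestions; case: e he => // p' k' v' he.
    case: ifP => // _; have [j _ hj] := recv_suggest_inv he.
    by rewrite (con_proposals_true (server_guard hj)).
case: (server_step i s) => [e|[e [he ee]]]; first by rewrite e (negPf kn).
rewrite ee => kp; have [v kc] := handle_con_proposals_new kp kn.
rewrite -ee in kc *; constructor 1; apply: pending kc _.
(* A first proposal cannot come after the date, when the key would be registered and so already
   proposed. *)
move: kp; rewrite handle_proposed (negPf kn) orbF => /(proposes_submitted he)[j _ hk].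
rewrite leNgt; apply/negP => /ltW /(registered_by s hk) /and3P[_ kp _].
by rewrite kp in kn.
Qed.

(** The same stages for the beat scheduled at [k.2]; [t] pairs the announced time with the sending
    time. The guard of [Beat] bounds the former below, and urgency bounds the latter above. *)
Lemma time_progress k i s s' : k \in observed (srv_st i s) ->
  [\/ k.2 \in timers (srv_st i s) /\ tm i <= k.2,
      exists t, [/\ k.2 <= t.1, t.2 <= k.2 &
        List.In (MTime t.1, t.2) (links (st i) (srv s) (srv s'))]
    | (k.2%:E <= remote_times (srv_st i s') s)%O].
Proof.
elim: i => [|i ih]; first by rewrite inE.
have pending : k.2 \in timers (srv_st i.+1 s) -> tm i <= k.2 ->
    k.2 \in timers (srv_st i.+1 s) /\ tm i.+1 <= k.2.
  move=> h hi; split=> //.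
  by apply: (@urgent _ s (Beat k.2)) hi; split.
case: (boolP (k \in observed (srv_st i s))) => [/ih {}ih _|kn].
  case: ih => [[kc hi]|[t [ht1 ht2 hin]]|hs].
  - case: (server_step i s) => [e|[e [he ee]]].
      by constructor 1; apply: pending; rewrite ?e.
    have [h|ep] := handle_timers_kept f (tm i) e kc.
      by constructor 1; apply: pending; rewrite ?ee.
    rewrite ep in he; constructor 2; exists (tm i, tm i).
    have [_ hb] := server_guard he; split=> //.
    by apply/sent_links/(event_sent _ he); left.
  - have [h|hin'] := links_kept hin; first by constructor 2; exists t.
    have ev : events x i = AtServer s' (RecvTime s t.1).
      case: (events x i) hin' => // [s1 [] //= p|c [] //= p m b v [_ _]] //.
      by move=> t' [/srv_inj -> /srv_inj -> ->].
    constructor 3; rewrite (server_stepE ev) handle_remote_times eqxx.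
    by rewrite le_max lee_fin ht1 orbT.
  - constructor 3; case: (server_step i s') => [-> //|[e [he ->]]].
    rewrite handle_remote_times; case: e he => // p' t _.
    by case: ifP => // _; rewrite le_max hs.
case: (server_step i s) => [e|[e [he ee]]]; first by rewrite e (negPf kn).
rewrite ee handle_observed (negPf kn) orbF -ee => sk.
constructor 1; apply: pending; first by rewrite ee handle_timers_new.
have [j _ hk] := spots_submitted he sk.
rewrite leNgt; apply/negP => /ltW /(registered_by s hk) /and3P[ko _ _].
by rewrite ko in kn.
Qed.

(** The flag is raised together with a pending con.Decide, which leaves the list only when
    [HandleDecide] records a decision. *)
Lemma decided_progress i s k : decided (blink (srv_st i s) k) ->
  decisions (srv_st i s) k != None \/
  exists v, (k, v) \in con_decisions (srv_st i s).
Proof.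
elim: i => [//|i ih]; case: (server_step i s) => [->//|[e [he ->]]].
case/handle_decided => [/ih|]; last by right.
case=> [h|[v hv]].
  by left; rewrite handle_decisions; case: e {he} => // k' v; case: ifP.
have [h|ev] := handle_con_decisions_kept f (tm i) e hv; first by right; exists v.
by left; rewrite handle_decisions ev eqxx.
Qed.

Lemma delivered_triggers i s c m : (c, m) \in delivered (srv_st i s) ->
  exists2 j, (j < i)%N &
    triggers f srv cli Delta eps clock x s (TobDeliver c m) j.
Proof.
elim: i => [|i ih]; first by rewrite inE.
case: (server_step i s) => [->|[e [he ->]]].
  by case/ih => j hj h; exists j => //; apply: ltnW.
case/handle_delivered => [/ih[j hj h]|ho]; first by exists j => //; apply: ltnW.
exists i => //; split; first by exists e.
by exists 0%N; rewrite (server_outE he) ho.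
Qed.

(** * Processing order: no submitted key is skipped *)

Lemma key_le_date k k' : key_le k k' -> k.2 <= k'.2.
Proof. by rewrite /key_le /rank leEprodlexi => /andP[]. Qed.

Lemma key_le_anti k k' : key_le k k' -> key_le k' k -> k = k'.
Proof.
move=> h1 h2; have : rank k = rank k' by apply: le_anti; rewrite [X in X && _]h1.
by case: k {h1 h2} => [[? ?] ?]; case: k' => [[? ?] ?] [-> -> ->].
Qed.

(** Consider a step [Process k'] with [k] at most [k']. If [k] is still unprocessed, the locked date
    of [k'] puts real time past [k.2], so [k] is a candidate and minimality gives [k' = k], decided
    True. Otherwise the previous value of [last_processed] was already at least [k], and induction
    applies. *)
Lemma processed_delivered i s k i0 l : submitted k i0 ->
  last_processed (srv_st i s) = Some l -> key_le k l ->
  (k.1.1, k.1.2) \in delivered (srv_st i s).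
Proof.
move=> hk; elim: i l => [//|i ih] l.
case: (server_step i s) => [->|[e [he ->]]]; first exact: ih.
rewrite handle_last_processed.
have keep : (k.1.1, k.1.2) \in delivered (srv_st i s) ->
    (k.1.1, k.1.2) \in delivered (server_handle f (tm i) (srv_st i s) e).1.
  exact: handle_delivered_kept.
case: e he keep => [p k' v|p t|p k'|c m b|k' v|k' v|k' v|k' v|k' v|b|k'|k'] he keep;
  try by move=> /ih h /h.
move=> [<-] kk'; have [[_ _] kmin kd kt] := server_guard he.
have [ku|ku] : (unprocessed (srv_st i s) k) \/
    (exists2 l0, last_processed (srv_st i s) = Some l0 & key_le k l0).
- rewrite /unprocessed; case: (last_processed _) => [l0|]; last by left.
  by case: (leP (rank k) (rank l0)) => h; [right; exists l0|left].
- have hi : k.2 <= tm i.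
    apply: le_trans (key_le_date kk') _; rewrite -lee_fin.
    exact: le_trans kt (lock_time_le _ _).
  have /and3P[_ _ kc] := registered_by s hk hi.
  rewrite (key_le_anti kk' (kmin _ kc ku)); apply: process_delivered.
  by case: (decisions _ _) kd (@decisions_true i s k') => // [[//|]] _ /(_ false erefl).
- by case: ku => l0 h1 h2; apply/keep/(ih _ h1).
Qed.

(** * The last state reached by the deadline *)

Lemma decisions_by k i0 j s T : #|Server| = (5 * f + 1)%N ->
  submitted k i0 -> k.2 + Delta <= T -> tm j <= T < tm j.+1 ->
  decisions (srv_st j.+1 s) k != None.
Proof.
move=> hn hk kT /andP[jT Tj].
have kj : k.2 < tm j.+1.
  by apply: le_lt_trans Tj; apply: le_trans kT; rewrite lerDl ltW.
(* Step [j] is the last one by [T], so urgency leaves no handler enabled at [T] after it. *)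
have idle e : server_enabled f T (srv_st j.+1 s) e -> False.
  by move/urgent=> /(_ jT); rewrite leNgt Tj.
have sug p : suggestions (blink (srv_st j.+1 s) k) p = Some true.
  have /and3P[_ kp _] := registered_by p hk (ltW kj).
  case: (suggest_progress s kp) => [[_]|[t ht /links_deadline /= h]|//].
    by rewrite leNgt kj.
  have : T < t + Delta by apply: lt_le_trans Tj h.
  by rewrite ltNge (le_trans _ kT) // lerD2r.
(* All [5 * f + 1] suggestions are True, which exceeds the fast quorum [4 * f + 1]; an undecided
   server would have [QuorumDecide] enabled. *)
have kd : decided (blink (srv_st j.+1 s) k).
  case: (boolP (decided _)) => // nd.
  case: (idle (QuorumDecide k true)); split=> //.
  have -> : Defs.support (blink (srv_st j.+1 s) k) true = #|Server|.
    rewrite /Defs.support -cardsT; congr #|pred_of_set _|.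
    by apply/setP => p; rewrite !inE sug eqxx.
  by rewrite hn leq_add2r leq_mul2r orbT.
by case: (decided_progress kd) => // -[v /(idle (HandleDecide k v))].
Qed.

Lemma lock_time_by k i0 j s T : #|Server| = (5 * f + 1)%N ->
  submitted k i0 -> k.2 + Delta <= T -> tm j <= T < tm j.+1 ->
  (k.2%:E <= lock_time f (srv_st j.+1 s))%O.
Proof.
move=> hn hk kT /andP[jT Tj].
have kj : k.2 < tm j.+1.
  by apply: le_lt_trans Tj; apply: le_trans kT; rewrite lerDl ltW.
(* By maximality of the lock time it suffices that enough remote times reach [k.2]; in fact those of
   all servers do. *)
have [_ -> //] := lock_timeP (srv_st j.+1 s) hn.
rewrite /reaches (_ : [set p | _] = setT).
  by rewrite cardsT hn leq_add2r leq_mul2r orbT.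
apply/setP => p; rewrite !inE.
have /and3P[ko _ _] := registered_by p hk (ltW kj).
case: (time_progress s ko) => [[_]|[t [_ ht /links_deadline /= h]]|//].
  by rewrite leNgt kj.
have : T < t.2 + Delta by apply: lt_le_trans Tj h.
by rewrite ltNge (le_trans _ kT) // lerD2r.
Qed.

Lemma key_le_min (P : pred key) (l : seq key) k : k \in l -> P k ->
  exists k', [/\ k' \in l, P k' &
    forall k'', k'' \in l -> P k'' -> key_le k' k''].
Proof.
elim: l k => [//|a l ih] k; rewrite inE => kl Pk.
have [/hasP[k1 k1l Pk1]|/hasPn nP] := boolP (has P l).
  have [k2 [k2l Pk2 k2min]] := ih k1 k1l Pk1.
  have [/andP[Pa ak2]|na] := boolP (P a && key_le a k2).
    exists a; split=> [||k3]; rewrite ?mem_head // inE => /orP[/eqP -> _|k3l Pk3].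
      exact: lexx.
    exact: le_trans ak2 (k2min _ k3l Pk3).
  exists k2; split=> [||k3] //; first by rewrite inE k2l orbT.
  rewrite inE => /orP[/eqP ->|] Pk3; last exact: k2min.
  by move: na; rewrite Pk3 /= /key_le -ltNge => /ltW.
have ka : k = a by case/orP: kl => [/eqP //|/nP]; rewrite Pk.
exists k; split=> // k3; rewrite inE ka => /orP[/eqP -> _|/nP].
  exact: lexx.
by move=> /negPf ->.
Qed.

Lemma submitted_delivered k i0 s : #|Server| = (5 * f + 1)%N ->
  submitted k i0 ->
  delivers_by f srv cli Delta eps clock x s k.1.1 k.1.2 (k.2 + Delta).
Proof.
move=> hn hk; set T := k.2 + Delta.
have kT : k.2 <= T by rewrite lerDl ltW.
have [j jT] : exists j, tm j <= T < tm j.+1.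
  apply: last_step; apply: le_trans (times_le (leq0n i0)) _.
  apply: le_trans kT; apply: ltW; apply: le_lt_trans (submitted_deadline hk).
  by rewrite lerDl ltW.
have /andP[jT' Tj] := jT.
suff /delivered_triggers [i ij h] : (k.1.1, k.1.2) \in delivered (srv_st j.+1 s).
  by exists i; split=> //; apply: le_trans jT'; apply: times_le.
(* Boolean form of [unprocessed], as [key_le_min] takes a boolean predicate. *)
pose unp k' := if last_processed (srv_st j.+1 s) is Some l then key_lt l k' else true.
have unpP k' : unprocessed (srv_st j.+1 s) k' <-> unp k'.
  by rewrite /unprocessed /unp; case: last_processed.
have [ku|] := boolP (unp k); last first.
  rewrite /unp; case E: last_processed => [l|//]; rewrite /key_lt -leNgt.
  exact: processed_delivered hk E.
have /and3P[_ _ kc] := registered_by s hk (le_trans kT (ltW Tj)).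
have [k1 [k1c k1u k1min]] := key_le_min kc ku.
have k1k := key_le_date (k1min _ kc ku).
have [j1 _ hk1] := candidates_submitted k1c.
(* If [k] were unprocessed, the least unprocessed candidate [k1] would be ready at [T], since its
   date is at most that of [k]. This contradicts the choice of [j]. *)
suff /urgent /(_ jT') : server_enabled f T (srv_st j.+1 s) (Process k1).
  by rewrite leNgt Tj.
split.
- by split=> //; apply/unpP.
- by move=> k2 k2c /unpP; apply: k1min.
- by apply: decisions_by hn hk1 _ jT; rewrite lerD2r.
- by apply: lock_time_by hn hk1 _ jT; rewrite lerD2r.
Qed.

Lemma broadcast_submitted c m i : broadcasts x c m i ->
  submitted (c, m, tm i + Delta + eps) i.
Proof.
move=> h; split; first by exists (Broadcast m).
by rewrite /outputs h /= clock_exact expr0 mul1r; left.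
Qed.
End Execution.

Theorem theorem10 (R : realType) (f : nat) (Server : finType)
    (dC dM : Order.disp_t) (Client : orderType dC) (Msg : orderType dM)
    (Proc : eqType) (srv : Server -> Proc) (cli : Client -> Proc)
    (Delta est eps : R) (clock : Proc -> R -> R) (x : run R Server Client Msg)
    (card_servers : #|Server| = (5 * f + 1)%N)
    (srv_inj : injective srv) (cli_inj : injective cli)
    (Delta_gt0 : 0 < Delta) (eps_gt0 : 0 < eps)
    (est_exact : est = Delta)
    (clock_exact : forall (p : Proc) (tau : R), clock p tau = tau)
    (x_exec : execution f srv cli Delta est eps clock x)
    (x_once : no_rebroadcast x)
    (theta : Client) (m : Msg) (t : R)
    (x_broadcast : broadcasts_at x theta m t) (sigma : Server) :
  delivers_by f srv cli est eps clock x sigma theta m (t + 2 * Delta + eps).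
Proof.
case: x_broadcast => i [hb <-]; subst est.
(* The date of the first submission is [times x i + Delta + eps]; the other [Delta] covers the
   travel of suggestions and beats sent by that date. *)
have -> : times x i + 2 * Delta + eps = times x i + Delta + eps + Delta.
  by rewrite mulr_natl mulr2n addrA addrAC.
exact: (submitted_delivered srv_inj cli_inj Delta_gt0 eps_gt0 clock_exact x_exec
  sigma card_servers (broadcast_submitted clock_exact hb)).
Qed.
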